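(* In types $A$, $B$ and $\tilde C$ the following relation holds for all $n\ge 2$: $$A_n^{CFCI}(q)=B_n^{CFCI}(q)=\tilde C_{n-1}^{CFCI}(q)=A_{n-1}^{CFCI}(q)+q\,A_{n-2}^{CFCI}(q),$$ and $A_0^{CFCI}(q)=1$, $A_1^{CFCI}(q)=1+q$. Moreover, $$A^{CFCI}(x):=\sum_{n=1}^{\infty}A_{n-1}^{CFCI}(q)x^n=x\,\frac{1+qx}{1-x-qx^2}.$$
   Context: $A_n$: Coxeter group with $n$ generators, diagram a path with all edges $m=3$ ($A_0$ trivial). $B_n$: generators $t,s_1,\dots,s_{n-1}$, diagram the path $t-s_1-\cdots-s_{n-1}$ with $m_{ts_1}=4$ and other edges $m=3$. $\tilde C_n$: generators $t,s_1,\dots,s_{n-1},u$, diagram the path $t-s_1-\cdots-s_{n-1}-u$ with $m_{ts_1}=m_{s_{n-1}u}=4$ and other edges $m=3$; for $n=1$, $\tilde C_1$ is understood as the group generated by $t,u$ with a single edge $t-u$ ($m_{tu}=\infty$). An element of a Coxeter group $W$ (with length $\ell$) is fully commutative (FC) if any two of its reduced expressions are related by a sequence of transpositions of adjacent commuting generators. A cyclic shift of a word $s_{i_1}\cdots s_{i_k}$ is any word $s_{i_j}\cdots s_{i_k}s_{i_1}\cdots s_{i_{j-1}}$. An element is cyclically fully commutative (CFC) if every cyclic shift of every one of its reduced expressions is a reduced expression of an FC element; $W^{CFC}$ is the set of CFC elements. $I(W)=\{w\in W:w^2=1\}$ (including the identity), and $W^{CFCI}(q):=\sum_{w\in W^{CFC}\cap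 I(W)}q^{\ell(w)}$. *)

(* Defs.v *)
From HB Require Import structures.
From mathcomp Require Import all_boot all_order all_algebra.
From mathcomp Require Import generic_quotient finmap.
From mathcomp Require Import boolp classical_sets functions cardinality.
From Stdlib Require Import Relation_Operators Operators_Properties.

Set Implicit Arguments.
Unset Strict Implicit.
Unset Printing Implicit Defensive.

Section FormalPowerSeries.
Import GRing.Theory.
Local Open Scope ring_scope.

Record fps (R : Type) := Fps { fps_coef : nat -> R }.

HB.instance Definition _ (R : Type) := [isNew for @fps_coef R].
HB.instance Definition _ (R : Type) := gen_eqMixin (fps R).
HB.instance Definition _ (R : Type) := gen_choiceMixin (fps R).

Lemma fpsP (R : Type) (f g : fps R) :
  (forall n, fps_coef f n = fps_coef g n) -> f = g.
Proof. by move=> fg; apply: val_inj; apply: funext. Qed.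

Section Ring.
Variable R : comUnitRingType.
Implicit Types f g h : fps R.

Definition fps_zero : fps R := Fps (fun _ => 0).
Definition fps_opp f : fps R := Fps (fun n => - fps_coef f n).
Definition fps_add f g : fps R := Fps (fun n => fps_coef f n + fps_coef g n).

Fact fps_addA : associative fps_add.
Proof. by move=> f g h; apply: fpsP => n /=; rewrite addrA. Qed.
Fact fps_addC : commutative fps_add.
Proof. by move=> f g; apply: fpsP => n /=; rewrite addrC. Qed.
Fact fps_add0 : left_id fps_zero fps_add.
Proof. by move=> f; apply: fpsP => n /=; rewrite add0r. Qed.
Fact fps_addN : left_inverse fps_zero fps_opp fps_add.
Proof. by move=> f; apply: fpsP => n /=; rewrite addNr. Qed.

HB.instance Definition _ :=
  GRing.isZmodule.Build (fps R) fps_addA fps_addC fps_add0 fps_addN.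

Definition fpsC (c : R) : fps R := Fps (fun n => if n == 0%N then c else 0).
Definition fpsX : fps R := Fps (fun n => (n == 1%N)%:R).
Definition fps_mul f g : fps R :=
  Fps (fun n => \sum_(i < n.+1) fps_coef f i * fps_coef g (n - i)).

Let trunc N f : {poly R} := \poly_(i < N.+1) fps_coef f i.

Let truncM N f g k : (k <= N)%N ->
  fps_coef (fps_mul f g) k = (trunc N f * trunc N g)`_k.
Proof.
move=> kN; rewrite coefM /=; apply: eq_bigr => i _; rewrite !coef_poly !ltnS.
by rewrite (leq_trans _ kN) ?leq_ord // (leq_trans (leq_subr _ _) kN).
Qed.

Let coef_trunc N f k : (k <= N)%N -> (trunc N f)`_k = fps_coef f k.
Proof. by move=> kN; rewrite coef_poly ltnS kN. Qed.

Fact fps_mulA : associative fps_mul.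
Proof.
move=> f g h; apply: fpsP => n.
rewrite !(@truncM n) //.
transitivity ((trunc n f * (trunc n g * trunc n h))`_n).
  rewrite !coefM; apply: eq_bigr => i _; congr (_ * _).
  by rewrite coef_trunc ?leq_subr // (@truncM n) ?leq_subr.
rewrite mulrA !coefM; apply: eq_bigr => i _; congr (_ * _).
by rewrite coef_trunc ?leq_ord // (@truncM n) ?leq_ord.
Qed.
Fact fps_mulC : commutative fps_mul.
Proof. by move=> f g; apply: fpsP => n; rewrite !(@truncM n) // mulrC. Qed.
Fact fps_mul1 : left_id (fpsC 1) fps_mul.
Proof.
move=> f; apply: fpsP => n /=; rewrite big_ord_recl /= mul1r subn0.
by rewrite big1 ?addr0 // => i _; rewrite mul0r.
Qed.
Fact fps_mulDl : left_distributive fps_mul fps_add.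
Proof.
move=> f g h; apply: fpsP => n /=; rewrite -big_split /=.
by apply: eq_bigr => i _; rewrite mulrDl.
Qed.
Fact fps_one_neq0 : fpsC 1 != 0.
Proof.
apply/eqP => /(congr1 (fun f => fps_coef f 0)) /= /eqP.
by rewrite (oner_eq0 R).
Qed.

HB.instance Definition _ := GRing.Zmodule_isComNzRing.Build (fps R)
  fps_mulA fps_mulC fps_mul1 fps_mulDl fps_one_neq0.

(* The first n coefficients of the inverse of f, solving f * g = 1. *)
Fixpoint fps_inv_seq f n : seq R :=
  if n is m.+1 then
    let g := fps_inv_seq f m in
    rcons g (((m == 0%N)%:R - \sum_(i < m) fps_coef f (m - i) * g`_i)
             / fps_coef f 0)
  else [::].

Definition fps_unit : {pred fps R} :=
  fun f => fps_coef f 0 \is a GRing.unit.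
Definition fps_inv f : fps R :=
  if fps_unit f then Fps (fun n => (fps_inv_seq f n.+1)`_n) else f.

Let size_inv f n : size (fps_inv_seq f n) = n.
Proof. by elim: n => //= n IH; rewrite size_rcons IH. Qed.

Let nth_inv f n i : (i < n)%N ->
  (fps_inv_seq f n)`_i = (fps_inv_seq f i.+1)`_i.
Proof.
elim: n => // n IH; rewrite ltnS leq_eqVlt => /orP[/eqP-> // | lt_in].
by rewrite -IH //= nth_rcons size_inv lt_in.
Qed.

Fact fps_mulVf : {in fps_unit, left_inverse 1 fps_inv *%R}.
Proof.
move=> f uf; rewrite /fps_inv [fps_unit f]uf; apply: fpsP => n /=.
rewrite big_ord_recr /= nth_rcons size_inv ltnn eqxx subnn.
rewrite -[X in _ + X]mulrA mulVr // mulr1.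
under eq_bigr => i _ do
  rewrite -[nth _ _ _]/((fps_inv_seq f i.+1)`_i) mulrC -(@nth_inv f n) //.
by rewrite addrCA subrr addr0; case: eqP.
Qed.
Fact fps_unitP f g : g * f = 1 -> fps_unit f.
Proof.
move=> /(congr1 (fun h => fps_coef h 0)) /=.
rewrite big_ord1 subnn => gf; apply/unitrP; exists (fps_coef g 0).
by split; rewrite // mulrC.
Qed.
Fact fps_inv_out : {in [predC fps_unit], fps_inv =1 id}.
Proof. by move=> f /negPf nuf; rewrite /fps_inv [fps_unit f]nuf. Qed.

HB.instance Definition _ := GRing.ComNzRing_hasMulInverse.Build (fps R)
  fps_mulVf fps_unitP fps_inv_out.

End Ring.
End FormalPowerSeries.

Arguments fpsX {R}.

(* Coxeter groups.  The value 0 of a Coxeter matrix stands for infinity: the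
   corresponding relation (st)^0 = 1 is then vacuous. *)

Record coxeter_matrix (I : finType) := CoxeterMatrix {
  cox_m :> I -> I -> nat;
  cox_m_eq1 : forall s t, (cox_m s t == 1) = (s == t);
  cox_m_sym : forall s t, cox_m s t = cox_m t s
}.

Section CoxeterGroup.
Variables (I : finType) (M : coxeter_matrix I).
Implicit Types (s t : I) (u v : seq I).

(* Insertion or deletion of a relator (st)^m(s,t); since m(s,s) = 1 this
   includes ss = 1, so words in the generators suffice and the quotient monoid
   is the Coxeter group. *)
Inductive cox_step : seq I -> seq I -> Prop :=
  CoxStep u v s t :
    cox_step (u ++ flatten (nseq (M s t) [:: s; t]) ++ v) (u ++ v).

Definition cox_eqv : seq I -> seq I -> Prop :=
  clos_refl_sym_trans (seq I) cox_step.

Definition cox_eqvb : rel (seq I) := fun u v => `[< cox_eqv u v >].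

Fact cox_eqvb_refl : reflexive cox_eqvb.
Proof. by move=> u; apply/asboolP; apply: rst_refl. Qed.
Fact cox_eqvb_sym : symmetric cox_eqvb.
Proof. by move=> u v; apply/asboolP/asboolP; apply: rst_sym. Qed.
Fact cox_eqvb_trans : transitive cox_eqvb.
Proof.
move=> v u w /asboolP uv /asboolP vw; apply/asboolP.
exact: rst_trans uv vw.
Qed.

Canonical cox_equiv :=
  EquivRel cox_eqvb cox_eqvb_refl cox_eqvb_sym cox_eqvb_trans.

Definition coxeter_group := {eq_quot cox_equiv}%qT.

HB.instance Definition _ := Choice.on coxeter_group.
HB.instance Definition _ := EqQuotient.on coxeter_group.

Local Notation W := coxeter_group.
Local Notation cls u := (\pi_(W)%qT u).

Fact cox_piP u v : cls u = cls v <-> cox_eqv u v.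
Proof.
split; first by move/eqquotP/asboolP.
by move=> uv; apply/eqquotP/asboolP.
Qed.

Fact cox_eqv_ctx a b u v : cox_eqv u v -> cox_eqv (a ++ u ++ b) (a ++ v ++ b).
Proof.
elim=> [_ _ [x y s t]|x|x y _|x y z _ IH1 _]; last 3 first.
- exact: rst_refl.
- exact: rst_sym.
- exact: rst_trans IH1.
by apply: rst_step; rewrite -!catA !(catA a); constructor.
Qed.

Fact cox_eqv_cat u u' v v' :
  cox_eqv u u' -> cox_eqv v v' -> cox_eqv (u ++ v) (u' ++ v').
Proof.
move=> uu' vv'; apply: (@rst_trans _ _ _ (u' ++ v)).
  exact: (@cox_eqv_ctx [::] v).
by rewrite -[u' ++ v]cats0 -[u' ++ v']cats0 -!catA; apply: cox_eqv_ctx.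
Qed.

Fact cox_eqv_ss s : cox_eqv [:: s; s] [::].
Proof.
apply: rst_step; have := CoxStep [::] [::] s s.
by have /eqP-> : M s s == 1 by rewrite cox_m_eq1.
Qed.

Fact cox_eqv_revl u : cox_eqv (rev u ++ u) [::].
Proof.
elim: u => [|s u IH]; first exact: rst_refl.
apply: rst_trans IH; rewrite rev_cons cat_rcons.
exact: (@cox_eqv_ctx (rev u) u [:: s; s] [::] (cox_eqv_ss s)).
Qed.

Fact cox_eqv_revr u : cox_eqv (u ++ rev u) [::].
Proof. by have := cox_eqv_revl (rev u); rewrite revK. Qed.

Definition cox_one : W := cls [::].
Definition cox_mul (x y : W) : W := cls (repr x ++ repr y).
Definition cox_inv (x : W) : W := cls (rev (repr x)).

Fact cox_repr u : cox_eqv (repr (cls u)) u.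
Proof. by apply/cox_piP; rewrite reprK. Qed.

Fact cox_mul_pi u v : cox_mul (cls u) (cls v) = cls (u ++ v).
Proof. by apply/cox_piP; apply: cox_eqv_cat; apply: cox_repr. Qed.

Fact cox_mulA : associative cox_mul.
Proof.
move=> x y z; rewrite -[x]reprK -[y]reprK -[z]reprK.
move: (repr x) (repr y) (repr z) => u v w.
by rewrite (cox_mul_pi v) (cox_mul_pi u v) !cox_mul_pi catA.
Qed.
Fact cox_mul1 : left_id cox_one cox_mul.
Proof. by move=> x; rewrite -[x]reprK cox_mul_pi. Qed.
Fact cox_1mul : right_id cox_one cox_mul.
Proof. by move=> x; rewrite -[x]reprK cox_mul_pi cats0. Qed.
Fact cox_mulV : left_inverse cox_one cox_inv cox_mul.
Proof.
move=> x; rewrite -[X in cox_mul _ X]reprK cox_mul_pi.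
by apply/cox_piP/cox_eqv_revl.
Qed.
Fact cox_Vmul : right_inverse cox_one cox_inv cox_mul.
Proof.
move=> x; rewrite -[X in cox_mul X _]reprK cox_mul_pi.
by apply/cox_piP/cox_eqv_revr.
Qed.

HB.instance Definition _ :=
  isGroup.Build W cox_mulA cox_mul1 cox_1mul cox_mulV cox_Vmul.

Local Open Scope group_scope.

Definition cox_gen s : W := cls [:: s].

Definition cox_prod u : W := \prod_(s <- u) cox_gen s.

Fact cox_prodE u : cox_prod u = cls u.
Proof.
rewrite /cox_prod; elim: u => [|s u IH]; first by rewrite big_nil.
by rewrite big_cons IH; apply: cox_mul_pi.
Qed.

Fact cox_length_subproof (w : W) :
  exists k, `[< exists2 u, cox_prod u = w & size u = k >].
Proof.
exists (size (repr w)); apply/asboolP; exists (repr w) => //.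
by rewrite cox_prodE reprK.
Qed.

Definition cox_length (w : W) : nat := ex_minn (cox_length_subproof w).

Definition reduced u : Prop := size u = cox_length (cox_prod u).

Definition reduced_expr (w : W) u : Prop := cox_prod u = w /\ reduced u.

Inductive comm_step : seq I -> seq I -> Prop :=
  CommStep u v s t of commute (cox_gen s) (cox_gen t) :
    comm_step (u ++ [:: s; t] ++ v) (u ++ [:: t; s] ++ v).

Definition FC (w : W) : Prop :=
  forall u v, reduced_expr w u -> reduced_expr w v ->
    clos_refl_trans (seq I) comm_step u v.

Definition CFC (w : W) : Prop :=
  forall u, reduced_expr w u ->
    forall k, reduced (rot k u) /\ FC (cox_prod (rot k u)).

Definition involution (w : W) : Prop := w ^+ 2 = 1.

Definition CFCI_of_length (k : nat) : set W :=
  [set w | [/\ CFC w, involution w & cox_length w = k]].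

Fact finite_CFCI_of_length k : finite_set (CFCI_of_length k).
Proof.
apply: (@sub_finite_set _ _
  [set cox_prod (val u) | u in [set: k.-tuple I]]%classic); last first.
  by apply: finite_image; apply: finite_finset.
move=> w [_ _]; rewrite /cox_length; case: ex_minnP => m /asboolP[u uw um] _ mk.
have uk : size u == k by rewrite um mk.
by exists (Tuple uk).
Qed.

(* sum of q^(length w) over the CFC involutions w, as a power series in q *)
Definition CFCI : fps int :=
  Fps (fun k => Posz #|` fset_set (CFCI_of_length k)|).

End CoxeterGroup.

(* Coxeter matrix on 0, ..., N-1 whose diagram is a path, the edge between i and
   i+1 carrying the label e i. *)

Section PathDiagram.
Variables (N : nat) (e : nat -> nat).

Definition path_m (i j : 'I_N) : nat :=
  if i == j then 1
  else if j == i.+1 :> nat then e i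
  else if i == j.+1 :> nat then e j
  else 2.

Hypothesis e_neq1 : forall i, e i != 1.

Fact path_m_eq1 i j : (path_m i j == 1) = (i == j).
Proof.
rewrite /path_m; case: (i == j) => //.
case: ifP => _; first exact/negbTE.
by case: ifP => _ //; exact/negbTE.
Qed.

Fact path_m_sym i j : path_m i j = path_m j i.
Proof.
rewrite /path_m eq_sym; case: (j == i) => //.
case: (eqVneq (j : nat) i.+1) => [ji | _]; last by [].
case: eqVneq => // ij; move/eqP: (congr1 S ij).
by rewrite -ji ltn_eqF // leqnSn.
Qed.

Definition path_matrix : coxeter_matrix 'I_N :=
  CoxeterMatrix path_m_eq1 path_m_sym.
End PathDiagram.

Definition label_A (i : nat) : nat := 3.
Definition label_B (i : nat) : nat := if i == 0 then 4 else 3.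
Definition label_Ct (n i : nat) : nat :=
  if n == 1 then 0
  else if (i == 0) || (i == n.-1) then 4
  else 3.

Fact label_A_neq1 i : label_A i != 1. Proof. by []. Qed.
Fact label_B_neq1 i : label_B i != 1. Proof. by rewrite /label_B; case: ifP. Qed.
Fact label_Ct_neq1 n i : label_Ct n i != 1.
Proof. by rewrite /label_Ct; do 2?case: ifP. Qed.

Definition coxA (n : nat) : coxeter_matrix 'I_n := path_matrix n label_A_neq1.

(* t = 0 and s_i = i; for n >= 2 *)
Definition coxB (n : nat) : coxeter_matrix 'I_n := path_matrix n label_B_neq1.

(* t = 0, s_i = i and u = n; for n >= 1, with m(t,u) infinite when n = 1 *)
Definition coxCt (n : nat) : coxeter_matrix 'I_n.+1 :=
  path_matrix n.+1 (label_Ct_neq1 n).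

(* Main.v *)
Require Import Defs.
From mathcomp Require Import all_boot all_order all_algebra zify ring.
From mathcomp Require Import finmap boolp cardinality.
From Stdlib Require Import Relation_Operators.
Import GRing.Theory Num.Theory.
Local Open Scope ring_scope.

Set Implicit Arguments.
Unset Strict Implicit.
Unset Printing Implicit Defensive.

(** Both halves of the theorem follow from one description: for a path diagram
    with labels 3, 4 or infinity, the CFC involutions are the products of sets
    of pairwise non-adjacent generators, the length being the size of the set.
    This depends on the path alone, so the three families give the generating
    polynomials of the independent sets of a path, counted by size.  These obey
    a Fibonacci-type recurrence (an independent set of the path on n + 2
    vertices either avoids the first vertex, or contains it and avoids the
    second), and a linear recurrence is the same thing as a rational generating
    series.

    A CFC involution is a product of distinct commuting generators, in any
    Coxeter group (CFCI_uniq_commute).  If u is a reduced word of w, so is its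
    reversal, because w is its own inverse; full commutativity relates the two
    by commutations.  These preserve the subword on two non-commuting
    letters s and t, so this subword is a palindrome.  Let s be the first letter
    of u.  The letters after its last occurrence commute with it, otherwise some
    palindrome would start with s and end with another letter.  If s occurred
    twice, its last occurrence could therefore be moved to the end, and a cyclic
    shift would bring two copies of s together, against cyclic reducedness.
    So s occurs once and commutes with every other letter; then the cyclic
    shift of u by one is again a reduced word of w, and each letter of u gets
    its turn as first letter.

    Conversely, let S be a set of commuting generators.  In the reflection
    representation of an integral Cartan matrix, the product of S negates the
    simple root of each s in S, whereas a word without s fixes the coordinate on
    that root.  Hence any word for this product contains all letters of S
    (subset_of_cox_prod_eq), so the reduced words are the orderings of S,
    and all of the CFC conditions follow.  The same representation shows that
    adjacent generators do not commute. *)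

(** * Words, commutation classes and cyclic shifts *)

Lemma mulg_eq1_invg (G : groupType) (x y : G) : (x * y = 1 -> x^-1 = y)%g.
Proof. by move=> xy; rewrite -[LHS]mulg1 -xy mulKg. Qed.

Section Words.
Variables (I : finType) (M : coxeter_matrix I).
Implicit Types (s t : I) (u v : seq I) (w : coxeter_group M).
Local Open Scope group_scope.

Lemma cox_prod_cat u v : cox_prod M (u ++ v) = cox_prod M u * cox_prod M v.
Proof. by rewrite /cox_prod big_cat. Qed.

Lemma cox_prod_cons s u : cox_prod M (s :: u) = cox_gen M s * cox_prod M u.
Proof. by rewrite /cox_prod big_cons. Qed.

Lemma cox_prod1 s : cox_prod M [:: s] = cox_gen M s.
Proof. exact: cox_prodE. Qed.

Lemma cox_gen_sq s : cox_gen M s * cox_gen M s = 1.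
Proof.
by rewrite -{2}cox_prod1 -cox_prod_cons cox_prodE; apply/cox_piP/cox_eqv_ss.
Qed.

Lemma cox_genV s : (cox_gen M s)^-1 = cox_gen M s.
Proof. exact/mulg_eq1_invg/cox_gen_sq. Qed.

Lemma cox_prod_rev u : cox_prod M (rev u) = (cox_prod M u)^-1.
Proof.
elim: u => [|s u IH]; first by rewrite /cox_prod !big_nil invg1.
rewrite rev_cons -cats1 cox_prod_cat cox_prod1 cox_prod_cons invgM IH.
by rewrite cox_genV.
Qed.

Lemma cox_length_le u : (cox_length (cox_prod M u) <= size u)%N.
Proof.
by rewrite /cox_length; case: ex_minnP => m _; apply; apply/asboolP; exists u.
Qed.

Lemma reduced_exists w : exists u, reduced_expr w u.
Proof.
have /asboolP[u uw um] : `[< exists2 u, cox_prod M u = w &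
    size u = cox_length w >] by rewrite /cox_length; case: ex_minnP.
by exists u; split; rewrite // /reduced uw.
Qed.

Lemma commute_cox_prod s u :
  (forall t, t \in u -> commute (cox_gen M s) (cox_gen M t)) ->
  commute (cox_gen M s) (cox_prod M u).
Proof.
by move=> su; rewrite /cox_prod big_seq; apply: commute_prod.
Qed.

Lemma commute_cox_m2 s t : M s t = 2%N -> commute (cox_gen M s) (cox_gen M t).
Proof.
move=> Mst; have : cox_prod M [:: s; t; s; t] = cox_prod M [::].
  rewrite !cox_prodE; apply/cox_piP/rst_step.
  by have := CoxStep M [::] [::] s t; rewrite Mst.
rewrite (cox_prod_cat [:: s; t] [:: s; t]) [RHS]big_nil => /mulg_eq1_invg.
by rewrite -cox_prod_rev /cox_prod /= !big_cons !big_nil !mulg1.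
Qed.

Local Notation comm_eqv := (clos_refl_trans (seq I) (@comm_step I M)).

Lemma comm_eqv_cons s u v : comm_eqv u v -> comm_eqv (s :: u) (s :: v).
Proof.
elim=> [_ _ [a b x y xy]|x|x y z _ IH1 _ IH2]; last 2 first.
- exact: rt_refl.
- exact: rt_trans IH1 IH2.
by apply: rt_step; apply: (CommStep (s :: a) b xy).
Qed.

Lemma comm_eqv_perm u v :
  {in u &, forall s t, commute (cox_gen M s) (cox_gen M t)} ->
  perm_eq u v -> comm_eqv u v.
Proof.
elim: u v => [|s u IH] v uC uv.
  by move: uv; rewrite perm_sym => /perm_nilP->; apply: rt_refl.
have sv : s \in v by rewrite -(perm_mem uv) mem_head.
have vu x : x \in v -> x \in s :: u by rewrite (perm_mem uv).
case/splitPr: sv uv vu => a b uv vu.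
have {}uv : perm_eq u (a ++ b).
  rewrite -(perm_cons s) (permPl uv) -cat_cons perm_catC /= perm_cons.
  by rewrite perm_catC.
apply: (@rt_trans _ _ _ (s :: a ++ b)).
  apply/comm_eqv_cons/IH => // x y xu yu.
  by apply: uC; rewrite inE ?xu ?yu orbT.
have {}vu x : x \in a -> x \in s :: u by move=> xa; apply: vu; rewrite mem_cat xa.
elim: a vu {uv} => [|x a IHa] vu; first exact: rt_refl.
apply: (@rt_trans _ _ _ (x :: s :: a ++ b)); last first.
  by apply/comm_eqv_cons/IHa => y ya; apply: vu; rewrite inE ya orbT.
apply: rt_step; apply: (CommStep [::] (a ++ b)).
by apply: uC; rewrite ?mem_head //; apply: vu; rewrite mem_head.
Qed.

Lemma comm_eqv_prod u v : comm_eqv u v -> cox_prod M u = cox_prod M v.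
Proof.
elim=> [_ _ [a b x y xy]|//|x y z _ -> //].
by rewrite !cox_prod_cat; congr (_ * (_ * _)); rewrite !cox_prod_cons !mulgA xy.
Qed.

(** The trace-monoid invariant: an elementary commutation never exchanges two
    distinct non-commuting letters, so their relative order is that of the
    word. *)
Lemma comm_eqv_proj s t u v : ~ commute (cox_gen M s) (cox_gen M t) ->
  comm_eqv u v -> filter (pred2 s t) u = filter (pred2 s t) v.
Proof.
move=> st; elim=> [_ _ [a b x y xy]|//|x y z _ -> //].
rewrite !filter_cat /=; congr (_ ++ (_ ++ _)).
case: (x =P s) xy => [->|_] /=; case: (y =P s) => [->|_] //=.
- by case: (y =P t) => [-> /st|].
- case: (x =P t) => [->|//] ts; by case: st; apply: commute_sym.
- by case: (x =P t) => [->|//] /=; case: (y =P t) => [->|].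
Qed.

Lemma split_last_occurrence s u : s \in u ->
  exists a b, u = a ++ s :: b /\ s \notin b.
Proof.
elim: u => // x u IH; rewrite inE.
have [su _|su] := boolP (s \in u).
  by have [a [b [-> sb]]] := IH su; exists (x :: a), b.
by rewrite orbF => /eqP<-; exists [::], u.
Qed.

Section CFCInvolution.
Variable w : coxeter_group M.
Hypotheses (wC : CFC w) (wI : involution w).

(** As w is its own inverse, u and its reversal are two reduced words of the
    same fully commutative element, hence have the same projections. *)
Lemma CFCI_palindrome s t u : ~ commute (cox_gen M s) (cox_gen M t) ->
  reduced_expr w u ->
  rev (filter (pred2 s t) u) = filter (pred2 s t) u.
Proof.
move=> st wu; rewrite -filter_rev; apply/esym/comm_eqv_proj => //.
have [_] := wC wu 0; rewrite rot0; have [uw ru] := wu.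
have revw : cox_prod M (rev u) = w.
  rewrite cox_prod_rev uw; apply: mulg_eq1_invg.
  by rewrite -wI expgS expg1.
rewrite uw => /(_ u (rev u)); apply => //; split => //.
by rewrite /reduced size_rev revw -uw.
Qed.

(** A letter t of b not commuting with s would put t, and no s, at the end of
    the projection to s and t; but this projection is a palindrome that starts
    with s. *)
Lemma CFCI_suffix_commute s u b : reduced_expr w (s :: u) ->
  suffix b (s :: u) -> s \notin b ->
  forall t, t \in b -> commute (cox_gen M s) (cox_gen M t).
Proof.
move=> wu /suffixP[a ub] sb t tb; apply: contrapT => st.
have := CFCI_palindrome st wu; rewrite ub filter_cat.
set p := filter _ a; set r := filter _ b => pal.
have head_s : head t (p ++ r) = s.
  by rewrite /p /r -filter_cat -ub /= eqxx.
have tr : t \in r by rewrite mem_filter /= eqxx orbT.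
have : last t r = s.
  rewrite -head_s -pal rev_cat.
  by case/lastP: r tr {pal head_s} => // r x _; rewrite rev_rcons last_rcons.
move=> ls; suff : s \in r by rewrite mem_filter (negPf sb) andbF.
by rewrite -ls; case: r tr {pal head_s ls} => //= x r _; apply: mem_last.
Qed.

(** A second occurrence of the first letter s could be moved to the end of the
    word; the cyclic shift by one then ends with the non-reduced factor ss. *)
Lemma CFCI_head s u : reduced_expr w (s :: u) ->
  s \notin u /\ forall t, t \in u -> commute (cox_gen M s) (cox_gen M t).
Proof.
move=> wu; have su : s \notin u.
  apply/negP => /split_last_occurrence[a [b [ub sb]]].
  have sC : commute (cox_gen M s) (cox_prod M b).
    apply: commute_cox_prod; apply: (CFCI_suffix_commute wu) => //.
    by apply/suffixP; exists (s :: rcons a s); rewrite ub /= cat_rcons.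
  (* the last occurrence of s, moved across b to the end of the word *)
  have wv : reduced_expr w (s :: a ++ b ++ [:: s]).
    have [uw ru] := wu.
    have vw : cox_prod M (s :: a ++ b ++ [:: s]) = w.
      by rewrite -uw ub -!cat_cons !cox_prod_cat cox_prod1 -sC -cox_prod_cons.
    split=> //; rewrite /reduced vw -uw -ru ub /= !size_cat /= addn1.
    by rewrite addnS.
  have [+ _] := wC wv 1%N; rewrite rot1_cons /reduced.
  have -> : cox_prod M (rcons (a ++ b ++ [:: s]) s) = cox_prod M (a ++ b).
    rewrite -cats1 -!catA !cox_prod_cat !cox_prod1 cox_gen_sq.
    by rewrite mulg1.
  move=> szE; have := cox_length_le (a ++ b); rewrite -szE.
  by rewrite size_rcons !size_cat addnA addn1 ltnNge leqnSn.
split=> //; apply: (CFCI_suffix_commute wu) => //.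
by apply/suffixP; exists [:: s].
Qed.

(** The first letter commutes with the rest, so shifting the word by one does
    not change its product, and the argument applies again to the new word. *)
Lemma CFCI_rot k u : reduced_expr w u -> reduced_expr w (rot k u).
Proof.
move=> wu; have [uk|/ltnW] := leqP (size u) k; first by rewrite rot_oversize.
elim: k => [|k IH] uk; first by rewrite rot0.
have {IH} := IH (ltnW uk); rewrite -add1n rotD //.
have : size (rot k u) != 0%N by rewrite size_rot -lt0n (leq_trans _ uk).
case: (rot k u) => // s v _ wv; rewrite rot1_cons.
have [_ sC] := CFCI_head wv; have [vw rv] := wv.
have v'w : cox_prod M (rcons v s) = w.
  rewrite -cats1 cox_prod_cat cox_prod1 -vw cox_prod_cons.
  exact/esym/commute_cox_prod.
by split=> //; rewrite /reduced v'w -vw -rv size_rcons.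
Qed.

Lemma CFCI_uniq_commute u : reduced_expr w u ->
  uniq u /\ {in u &, forall s t, commute (cox_gen M s) (cox_gen M t)}.
Proof.
move=> wu.
(* a rotation brings any letter to the front, where it is isolated *)
have isolated s : s \in u -> exists v, [/\ perm_eq u (s :: v), s \notin v &
    forall t, t \in v -> commute (cox_gen M s) (cox_gen M t)].
  move=> /rot_to[k v uk]; exists v.
  have [|sv sC] := @CFCI_head s v; first by rewrite -uk; apply: CFCI_rot.
  by split; rewrite // -uk perm_sym perm_rot.
split=> [|s t su tu]; last first.
  have [v [uv _ sC]] := isolated s su.
  move: tu; rewrite (perm_mem uv) inE => /orP[/eqP->|/sC //].
  exact: commute_refl.
apply: count_mem_uniq => s; have [/isolated[v [uv sv _]]|/count_memPn-> //] :=
  boolP (s \in u).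
by rewrite (permP uv) /= eqxx (count_memPn sv).
Qed.

End CFCInvolution.
End Words.

(** * The reflection representation of a Cartan matrix *)

Section Reflections.
Variables (I : finType) (a : I -> I -> int).
Implicit Types (s t : I) (u : seq I) (v : I -> int).

(** Vectors are the coordinate functions on the basis of simple roots; the
    pairing is with the simple coroot of t. *)
Definition pairing t v : int := \sum_j v j * a j t.
Definition refl t v : I -> int := fun i => v i - pairing t v * (i == t)%:R.
(** The last letter of a word acts first, so that concatenation becomes
    composition. *)
Definition act u v : I -> int := foldr refl v u.
(** Reflections in s and t move v inside the plane v + <root s, root t>, where
    they act on the two parameters by the affine maps of the next lemmas; the
    braid relations become polynomial identities in these parameters. *)
Definition shift s t v (x y : int) : I -> int :=
  fun i => v i + x * (i == s)%:R + y * (i == t)%:R.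

Lemma sum_delta s (f : I -> int) (x : int) :
  \sum_j x * (j == s)%:R * f j = x * f s.
Proof.
rewrite (bigD1 s) //= eqxx mulr1 big1 ?addr0 // => j /negPf->.
by rewrite mulr0 mul0r.
Qed.

Lemma pairing_shift r s t v x y :
  pairing r (shift s t v x y) = pairing r v + x * a s r + y * a t r.
Proof.
rewrite /pairing /shift; under eq_bigr do rewrite !mulrDl.
by rewrite !big_split /= !sum_delta.
Qed.

Lemma shift00 s t v : shift s t v 0 0 = v.
Proof. by apply: funext => i; rewrite /shift !mul0r !addr0. Qed.

Lemma refl_shift_l s t v x y : a s s = 2 ->
  refl s (shift s t v x y) = shift s t v (- x - pairing s v - y * a t s) y.
Proof.
by move=> ss; apply: funext => i; rewrite /refl pairing_shift ss /shift; ring.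
Qed.

Lemma refl_shift_r s t v x y : a t t = 2 ->
  refl t (shift s t v x y) = shift s t v x (- y - pairing t v - x * a s t).
Proof.
by move=> tt; apply: funext => i; rewrite /refl pairing_shift tt /shift; ring.
Qed.

(** Each reflection changes only its own coordinate. *)
Lemma act_notin s u v : s \notin u -> act u v s = v s.
Proof.
elim: u => //= t u IH; rewrite inE negb_or => /andP[/negPf st /IH <-].
by rewrite /refl st mulr0 subr0.
Qed.

Definition root s (x : int) : I -> int := fun i => x * (i == s)%:R.

Lemma refl_root s t x i : refl t (root s x) i =
  x * (i == s)%:R - x * a s t * (i == t)%:R.
Proof. by rewrite /refl /pairing /root sum_delta. Qed.

(** Orthogonal reflections fix the root of s, so only the letter s itself acts,
    once. *)
Lemma act_root s u x : a s s = 2 -> uniq u ->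
  {in u, forall t, t != s -> a s t = 0} ->
  act u (root s x) = root s (if s \in u then - x else x).
Proof.
move=> ss; elim: u => //= t u IH /andP[tu uu] su.
rewrite IH //; last by move=> r ru; apply: su; rewrite inE ru orbT.
apply: funext => i; rewrite refl_root /root inE.
move: tu su; have [->|st] := eqVneq t s => tu su.
  by rewrite ss (negPf tu) /=; ring.
by rewrite (su t) ?mem_head //= ; ring.
Qed.

(** An integral Cartan matrix for the Coxeter matrix M.  The product of two
    reflections has order m when a s t * a t s = 4 cos (pi / m) ^ 2, which is
    1 or 2 for m = 3 or 4; over the integers m = 4 forces the asymmetric entries
    -1 and -2.  An infinite label gives no relation to check, and only
    non-orthogonality is asked. *)
Definition cartan_matrix (M : coxeter_matrix I) : Prop := forall s t,
  match M s t with
  | 0%N => a s t != 0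
  | 1%N => a s t == 2
  | 2%N => a s t == 0
  | 3%N => (a s t == -1) && (a t s == -1)
  | 4%N => (a s t, a t s) \in [:: (-1, -2); (-2, -1)]
  | _ => false
  end.

Section Cartan.
Variable M : coxeter_matrix I.
Hypothesis aM : cartan_matrix M.

Lemma cartan_diag s : a s s = 2.
Proof.
have := aM s s; have /eqP-> : M s s == 1%N by rewrite cox_m_eq1.
by move/eqP.
Qed.

Lemma cartan_neq0 s t : M s t != 2%N -> a s t != 0.
Proof.
have := aM s t; case: (M s t) => [|[|[|[|[|//]]]]] //.
- by move/eqP->.
- by case/andP=> /eqP->.
- by rewrite !inE !xpair_eqE => /orP[]/andP[/eqP->].
Qed.

Lemma act_relator s t v : act (flatten (nseq (M s t) [:: s; t])) v = v.
Proof.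
rewrite -{1}(shift00 s t v); have := aM s t; have := aM t s.
have ss := cartan_diag s; have tt := cartan_diag t.
have := cox_m_eq1 M s t; rewrite -(cox_m_sym M s t).
case: (M s t) => [|[|[|[|[|//]]]]] /=.
- by rewrite shift00.
- move=> /esym/eqP<- _ _; rewrite !refl_shift_l // -[RHS](shift00 s s v).
  by congr shift; rewrite ss; ring.
- move=> _ /eqP ts /eqP st; rewrite !(refl_shift_l, refl_shift_r) //.
  by rewrite -[RHS](shift00 s t v) ts st; congr shift; ring.
- move=> _ _ /andP[/eqP st /eqP ts]; rewrite !(refl_shift_l, refl_shift_r) //.
  by rewrite -[RHS](shift00 s t v) ts st; congr shift; ring.
- move=> _ _; rewrite !inE !xpair_eqE.
  by case/orP=> /andP[/eqP st /eqP ts]; rewrite !(refl_shift_l, refl_shift_r) //;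
    rewrite -[RHS](shift00 s t v) ts st; congr shift; ring.
Qed.

Lemma act_cat u1 u2 v : act (u1 ++ u2) v = act u1 (act u2 v).
Proof. exact: foldr_cat. Qed.

Lemma act_cox_prod u1 u2 v :
  cox_prod M u1 = cox_prod M u2 -> act u1 v = act u2 v.
Proof.
rewrite !cox_prodE => /cox_piP.
elim=> [_ _ [b c s t]|//|x y _ -> //|x y z _ -> _ -> //].
by rewrite !act_cat act_relator.
Qed.

(** The t-coordinates of the images of root s under st and ts are - a s t and
    a s t. *)
Lemma act_not_commute s t : s != t -> M s t != 2%N ->
  ~ commute (cox_gen M s) (cox_gen M t).
Proof.
move=> st /cartan_neq0 nz C.
have stE : cox_prod M [:: s; t] = cox_prod M [:: t; s].
  by rewrite /cox_prod !big_cons !big_nil !mulg1 C.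
have := congr1 (@^~ t) (act_cox_prod (root s 1) stE).
have ts : t \notin [:: s] by rewrite inE eq_sym.
rewrite -(cat1s s [:: t]) -(cat1s t [:: s]) !act_cat (act_notin _ ts).
rewrite (@act_root s [:: s]) ?cartan_diag //; last first.
  by move=> r; rewrite inE => /eqP->; rewrite eqxx.
rewrite mem_head /= !refl_root eqxx eq_sym (negPf st) => /eqP.
rewrite !mulr0 !sub0r mulr1 mul1r mulN1r mulr1 opprK eqNr.
exact/negP.
Qed.

(** If s is in u1 but not in u2, then the s-coordinate of root s becomes -1
    under u1 and stays 1 under u2. *)
Lemma subset_of_cox_prod_eq u1 u2 : uniq u1 ->
  {in u1 &, forall s t, s != t -> M s t = 2%N} ->
  cox_prod M u1 = cox_prod M u2 -> {subset u1 <= u2}.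
Proof.
move=> uu uI uE s su; apply: contraT => su2.
have := congr1 (@^~ s) (act_cox_prod (root s 1) uE).
rewrite (act_notin _ su2) act_root ?cartan_diag //; last first.
  by move=> t tu ts; have := aM s t; rewrite uI 1?eq_sym // => /eqP.
by rewrite su /root eqxx.
Qed.
End Cartan.
End Reflections.

(** * CFC involutions and independent sets of generators *)

Section IndependentSets.
Variables (I : finType) (M : coxeter_matrix I).
Implicit Types (S T : {set I}) (u v : seq I).

Definition independent S : bool :=
  [forall s in S, forall t in S, (s != t) ==> (M s t == 2%N)].

Definition independent_sets k : {set {set I}} :=
  [set S | independent S & #|S| == k].

Lemma independentP S :
  reflect {in S &, forall s t, s != t -> M s t = 2%N} (independent S).
Proof.
apply: (iffP forall_inP) => SI s.
  move=> t sS tS st; move/(_ s sS)/forall_inP/(_ t tS): SI.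
  by rewrite st => /eqP.
by move=> sS; apply/forall_inP => t tS; apply/implyP => st; rewrite SI.
Qed.

Lemma independent_commute S u : independent S -> perm_eq u (enum S) ->
  {in u &, forall s t, commute (cox_gen M s) (cox_gen M t)}.
Proof.
move=> /independentP SI uS s t; rewrite !(perm_mem uS) !mem_enum => sS tS.
by have [->|st] := eqVneq s t; [apply: commute_refl | apply/commute_cox_m2/SI].
Qed.

Variable a : I -> I -> int.
Hypothesis aM : cartan_matrix a M.

(** A word for this product contains all of S, and a reduced one is no longer
    than enum S, so it has no room for anything else. *)
Lemma independent_perm S u : independent S ->
  cox_prod M u = cox_prod M (enum S) -> reduced M u -> perm_eq u (enum S).
Proof.
move=> /independentP SI uS ru.
have sub : {subset enum S <= u}.
  apply: (subset_of_cox_prod_eq aM); rewrite ?enum_uniq //.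
  by move=> s t; rewrite !mem_enum; apply: SI.
have le : (size u <= size (enum S))%N by rewrite ru uS cox_length_le.
have [_ eqS] := uniq_min_size (enum_uniq S) sub le.
rewrite perm_sym uniq_perm ?enum_uniq //.
exact: leq_size_uniq (enum_uniq S) sub le.
Qed.

Lemma independent_length S : independent S ->
  cox_length (cox_prod M (enum S)) = #|S|.
Proof.
move=> SI; have [u [uS ru]] := reduced_exists (cox_prod M (enum S)).
by rewrite -uS -ru (perm_size (independent_perm SI uS ru)) -cardE.
Qed.

Lemma independent_prod S u : independent S -> perm_eq u (enum S) ->
  cox_prod M u = cox_prod M (enum S).
Proof.
move=> SI uS; apply/comm_eqv_prod/comm_eqv_perm => //.
exact: independent_commute uS.
Qed.

Lemma independent_CFC S : independent S -> CFC (cox_prod M (enum S)).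
Proof.
move=> SI u [uS ru] k; have uP := independent_perm SI uS ru.
have rP : perm_eq (rot k u) (enum S) by rewrite perm_rot.
rewrite /reduced size_rot (independent_prod SI rP) ru uS; split=> //.
move=> u1 u2 [u1S ru1] [u2S ru2].
have p1 := independent_perm SI u1S ru1; have p2 := independent_perm SI u2S ru2.
apply: comm_eqv_perm; first exact: independent_commute p1.
by rewrite (permPl p1) perm_sym.
Qed.

Lemma independent_involution S : independent S ->
  involution (cox_prod M (enum S)).
Proof.
move=> SI; rewrite /involution expgS expg1.
have rS : perm_eq (rev (enum S)) (enum S) by rewrite perm_rev.
by rewrite -{2}(independent_prod SI rS) cox_prod_rev mulgV.
Qed.

Lemma CFCI_independent (w : coxeter_group M) : CFC w -> involution w ->
  exists2 S, independent S & w = cox_prod M (enum S).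
Proof.
move=> wC wI; have [u wu] := reduced_exists w.
have [uu uC] := CFCI_uniq_commute wC wI wu.
exists [set s in u].
  apply/independentP => s t; rewrite !inE => su tu st; apply/eqP.
  by apply: contraPT (uC s t su tu) => /(act_not_commute aM st).
have [<- _] := wu; apply/comm_eqv_prod/comm_eqv_perm => //.
by apply: uniq_perm; rewrite ?enum_uniq // => s; rewrite mem_enum inE.
Qed.

Lemma cox_prod_enum_inj :
  {in independent &, injective (fun S => cox_prod M (enum S))}.
Proof.
move=> S T SI TI ST; apply/eqP; rewrite eqEsubset.
have sub S1 S2 : independent S1 ->
    cox_prod M (enum S1) = cox_prod M (enum S2) -> S1 \subset S2.
  move=> /independentP S1I eqS; apply/subsetP => s.
  rewrite -[s \in S1]mem_enum -[s \in S2]mem_enum.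
  apply: (subset_of_cox_prod_eq aM) eqS s; rewrite ?enum_uniq // => s t.
  by rewrite !mem_enum; apply: S1I.
by rewrite !sub.
Qed.

(** The CFC involutions of length k correspond one to one to the independent
    sets with k elements. *)
Lemma coef_CFCI k : fps_coef (CFCI M) k = #|independent_sets k|.
Proof.
rewrite /CFCI /=; congr Posz.
have -> : fset_set (@CFCI_of_length _ M k) =
    [fset cox_prod M (enum (S : {set I})) | S in independent_sets k]%fset.
  apply/fsetP => w; rewrite in_fset_set; last exact: finite_CFCI_of_length.
  apply/idP/imfsetP => [|[S /= + ->]].
    move=> /classical_sets.set_mem[wC wI wk].
    have [S SI wS] := CFCI_independent wC wI.
    by exists S => //=; rewrite inE SI -(independent_length SI) -wS wk eqxx.
  rewrite inE => /andP[SI /eqP Sk]; apply: classical_sets.mem_set; split.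
  - exact: independent_CFC.
  - exact: independent_involution.
  - by rewrite independent_length.
rewrite card_in_imfset /=; last first.
  move=> S T; rewrite !inE => /andP[SI _] /andP[TI _].
  exact: cox_prod_enum_inj.
by rewrite cardE.
Qed.
End IndependentSets.

(** * Path diagrams *)

(** No two consecutive vertices: the independent sets of the path, stated
    without reference to the labels. *)
Definition sparse n (S : {set 'I_n}) : bool :=
  [forall i in S, forall j in S, j != i.+1 :> nat].

Definition sparse_sets n k : {set {set 'I_n}} :=
  [set S | sparse S & #|S| == k].

Lemma sparseP n (S : {set 'I_n}) :
  reflect {in S &, forall i j : 'I_n, j != i.+1 :> nat} (sparse S).
Proof.
apply: (iffP forall_inP) => Ss i.
  by move=> j iS jS; move/(_ i iS)/forall_inP/(_ j jS): Ss.
by move=> iS; apply/forall_inP => j jS; apply: Ss.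
Qed.

Section Path.
Variables (N : nat) (e : nat -> nat).
Hypothesis e_neq1 : forall i, e i != 1%N.
Hypothesis e_label : forall i, e i \in [:: 0; 3; 4]%N.

(** Of the two entries at an edge labelled 4, the one below the diagonal is
    taken to be -2. *)
Definition path_cartan (i j : 'I_N) : int :=
  if i == j then 2
  else if j == i.+1 :> nat then -1
  else if i == j.+1 :> nat then if e j == 4%N then -2 else -1
  else 0.

Lemma path_cartanP : cartan_matrix path_cartan (path_matrix N e_neq1).
Proof.
move=> i j; rewrite /= /path_m /path_cartan.
have [//|ij] := eqVneq i j.
have [ji|ji] := eqVneq (j : nat) i.+1;
  last have [ij'|ij'] := eqVneq (i : nat) j.+1.
- have -> : (i == j.+1 :> nat) = false by rewrite ji; lia.
  by have := e_label i; rewrite !inE => /or3P[] /eqP->.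
- by have := e_label j; rewrite !inE => /or3P[] /eqP->.
- by [].
Qed.

Lemma independent_path S : independent (path_matrix N e_neq1) S = sparse S.
Proof.
apply/independentP/sparseP => SI i j iS jS.
  have [ij|ij] := eqVneq i j; first by rewrite ij ltn_eqF.
  have := SI i j iS jS ij; rewrite /= /path_m (negPf ij).
  by case: ifP => // _ ei; have := e_label i; rewrite ei.
move=> ij; rewrite /= /path_m (negPf ij) (negPf (SI i j iS jS)).
by rewrite (negPf (SI j i jS iS)).
Qed.

Lemma CFCI_path :
  CFCI (path_matrix N e_neq1) = Fps (fun k => Posz #|sparse_sets N k|).
Proof.
apply: fpsP => k; rewrite (coef_CFCI path_cartanP); congr (Posz _).
by apply: eq_card => S; rewrite !inE independent_path.
Qed.
End Path.


(** * Counting independent sets of a path *)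

Section SparseSets.
Variable n : nat.
Implicit Types (S T : {set 'I_n.+1}).

(** The set T moved one step along the path, away from the new first vertex. *)
Definition up (T : {set 'I_n}) : {set 'I_n.+1} := lift ord0 @: T.

Lemma mem_up i (T : {set 'I_n}) : (lift ord0 i \in up T) = (i \in T).
Proof. exact/mem_imset/lift_inj. Qed.

Lemma ord0_up (T : {set 'I_n}) : ord0 \notin up T.
Proof. by apply/imsetP => -[i _ /eqP]; rewrite (negPf (neq_lift _ _)). Qed.

Lemma up_preimset S : ord0 \notin S -> up (lift ord0 @^-1: S) = S.
Proof.
move=> S0; apply/setP => i; case: (unliftP ord0 i) => [j ->|->].
  by rewrite mem_up inE.
by rewrite (negPf S0) (negPf (ord0_up _)).
Qed.

Lemma sparse_up (T : {set 'I_n}) : sparse (up T) = sparse T.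
Proof.
apply/sparseP/sparseP => Ts i j.
  by rewrite -!mem_up => iT jT; have := Ts _ _ iT jT; rewrite !lift0.
by move=> /imsetP[i' iT ->] /imsetP[j' jT ->]; rewrite !lift0 eqSS Ts.
Qed.

Lemma card_up (T : {set 'I_n}) : #|up T| = #|T|.
Proof. exact/card_imset/lift_inj. Qed.

Lemma card_sparse_notin k :
  #|sparse_sets n.+1 k :\: [set S : {set 'I_n.+1} | ord0 \in S]| =
    #|sparse_sets n k|.
Proof.
rewrite -(card_imset _ (imset_inj (@lift_inj _ (@ord0 n)))).
apply: eq_card => S; rewrite !inE; apply/andP/imsetP => [[S0 /andP[Ss Sk]]|].
  exists (lift ord0 @^-1: S); last by rewrite [RHS](up_preimset S0).
  by rewrite inE -sparse_up -card_up up_preimset ?Ss.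
case=> T; rewrite inE -[imset _ _]/(up T) => /andP[Ts Tk] ->.
by rewrite ord0_up sparse_up card_up Ts.
Qed.
End SparseSets.

Lemma up_preimset_in n (S : {set 'I_n.+1}) :
  ord0 \in S -> ord0 |: up (lift ord0 @^-1: S) = S.
Proof.
move=> S0; apply/setP => i; rewrite !inE.
case: (unliftP ord0 i) => [j ->|->]; last by rewrite S0.
by rewrite mem_up inE eq_sym (negPf (neq_lift _ _)).
Qed.

Lemma card_setU1_up n (T : {set 'I_n}) : #|ord0 |: up T| = #|T|.+1.
Proof. by rewrite cardsU1 ord0_up card_up. Qed.

Lemma preimset_setU1_up n (T : {set 'I_n}) : lift ord0 @^-1: (ord0 |: up T) = T.
Proof.
by apply/setP => i; rewrite !inE mem_up eq_sym (negPf (neq_lift _ _)).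
Qed.

Lemma setU1_up_inj n : injective (fun T : {set 'I_n} => ord0 |: up T).
Proof.
by move=> S T ST; rewrite -(preimset_setU1_up S) ST preimset_setU1_up.
Qed.

(** Adding the first vertex to a shifted set T creates a neighbouring pair
    exactly when T contained the first vertex of the shorter path. *)
Lemma sparse_setU1_up n (T : {set 'I_n.+1}) :
  sparse (ord0 |: up T) = (ord0 \notin T) && sparse T.
Proof.
apply/sparseP/andP => [Ts|[T0 /sparseP Ts] i j].
  split.
    apply/negP; rewrite -mem_up => T0.
    by have := Ts ord0 _ (setU11 _ _) (setU1r _ T0); rewrite lift0.
  rewrite -sparse_up; apply/sparseP => i j iT jT.
  by apply: Ts; rewrite setU1r.
move=> /setU1P[->|/imsetP[i' iT ->]] /setU1P[->|/imsetP[j' jT ->]] //;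
  rewrite !lift0 // eqSS ?Ts //.
by apply: contraNneq T0 => j0; rewrite -(_ : j' = ord0) //; apply: val_inj.
Qed.

(** Such sets also avoid the second vertex: they come from sparse sets of the
    path on n + 1 vertices that avoid its first vertex. *)
Lemma card_sparse_in n k :
  #|sparse_sets n.+2 k.+1 :&: [set S : {set 'I_n.+2} | ord0 \in S]| =
    #|sparse_sets n k|.
Proof.
rewrite -card_sparse_notin -(card_imset _ (@setU1_up_inj n.+1)).
apply: eq_card => S; rewrite !inE; apply/andP/imsetP => [[/andP[Ss Sk] S0]|].
  exists (lift ord0 @^-1: S); last by rewrite up_preimset_in.
  move: Ss Sk; rewrite -{1 2}(up_preimset_in S0) sparse_setU1_up card_setU1_up.
  by rewrite !inE => /andP[-> ->].
case=> T; rewrite !inE => /and3P[T0 Ts Tk] ->.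
by rewrite sparse_setU1_up card_setU1_up eqSS T0 Ts Tk setU11.
Qed.

(** * Generating series *)

Definition sparse_series n : fps int := Fps (fun k => Posz #|sparse_sets n k|).

Lemma coef_fpsX_mul (R : comUnitRingType) (f : fps R) k :
  fps_coef (fpsX * f) k = if k is k'.+1 then fps_coef f k' else 0.
Proof.
case: k => [|k] /=; first by rewrite big_ord1 mul0r.
rewrite 2!big_ord_recl /= mul0r add0r mul1r subSS subn0 big1 ?addr0 // => i _.
by rewrite mul0r.
Qed.

Lemma coef_fpsC_mul (R : comUnitRingType) c (f : fps R) k :
  fps_coef (fpsC c * f) k = c * fps_coef f k.
Proof.
rewrite /= big_ord_recl subn0 big1 ?addr0 // => i _.
by rewrite mul0r.
Qed.

Lemma sparse_series_rec n :
  sparse_series n.+2 = sparse_series n.+1 + fpsX * sparse_series n.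
Proof.
apply: fpsP => k; rewrite -[LHS]/(Posz #|sparse_sets n.+2 k|).
rewrite -[RHS]/(Posz #|sparse_sets n.+1 k| + fps_coef (fpsX * _) k).
rewrite coef_fpsX_mul.
rewrite -(cardsID [set S : {set 'I_n.+2} | ord0 \in S]) card_sparse_notin.
case: k => [|k]; last by rewrite card_sparse_in PoszD addrC.
lazy iota; rewrite addr0 (_ : _ :&: _ = set0) ?cards0 //; apply/setP => S.
rewrite !inE; case: eqP => [/eqP|]; rewrite ?andbF //.
by rewrite cards_eq0 => /eqP->; rewrite inE andbF.
Qed.

Lemma sparse_series0 : sparse_series 0 = 1.
Proof.
apply: fpsP => k; rewrite /=.
have -> : sparse_sets 0 k = if k == 0%N then [set set0] else set0.
  apply/setP => S; have -> : S = set0 by apply/setP => -[].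
  have s0 : sparse (set0 : {set 'I_0}) by apply/forall_inP => -[].
  by rewrite inE s0 cards0 eq_sym; case: eqP; rewrite !inE ?eqxx.
by case: eqP; rewrite ?cards1 ?cards0.
Qed.

Lemma sparse_series1 : sparse_series 1 = 1 + fpsX.
Proof.
rewrite -sparse_series0; apply: fpsP => k.
rewrite /= -(cardsID [set S : {set 'I_1} | ord0 \in S]) card_sparse_notin.
rewrite PoszD addrC; congr (_ + _).
have -> : sparse_sets 1 k :&: [set S : {set 'I_1} | ord0 \in S] =
    if k == 1%N then [set setT] else set0.
  apply/setP => S; rewrite !inE.
  have [S0|S0] := boolP (ord0 \in S); last first.
    rewrite andbF; case: eqP => _; rewrite inE //; apply/esym/negbTE/eqP => ST.
    by rewrite ST inE in S0.
  have -> : S = setT by apply/setP => i; rewrite ord1 S0 inE.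
  have sT : sparse (setT : {set 'I_1}).
    by apply/sparseP => i j _ _; rewrite !ord1.
  by rewrite sT cardsT card_ord eq_sym; case: eqP; rewrite !inE ?eqxx.
by case: eqP; rewrite ?cards1 ?cards0.
Qed.

Lemma CFCI_coxA n : CFCI (coxA n) = sparse_series n.
Proof. exact: CFCI_path. Qed.

Lemma CFCI_coxB n : CFCI (coxB n) = sparse_series n.
Proof. by apply: CFCI_path => i; rewrite /label_B; case: ifP. Qed.

Lemma CFCI_coxCt n : CFCI (coxCt n) = sparse_series n.+1.
Proof. by apply: CFCI_path => i; rewrite /label_Ct; do 2?case: ifP. Qed.

(** Multiplying the series by the denominator turns the coefficients into
    g (m + 2) - g (m + 1) - q g m, so only the first two of them survive. *)
Lemma fps_recurrence (R : comUnitRingType) (q : R) (g : nat -> R) :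
  g 0%N = 1 -> g 1%N = 1 + q -> (forall m, g m.+2 = g m.+1 + q * g m) ->
  Fps g = (1 + fpsC q * fpsX) / (1 - fpsX - fpsC q * fpsX ^+ 2).
Proof.
move=> g0 g1 gS; set D := (1 - _ - _).
have coefD k : fps_coef (Fps g * D) k =
    g k - (if k is k'.+1 then g k' else 0)
    - q * (if k is k'.+2 then g k' else 0).
  have -> : Fps g * D = Fps g - fpsX * Fps g - fpsC q * (fpsX * (fpsX * Fps g)).
    by rewrite /D; ring.
  rewrite -[LHS]/(_ - fps_coef (fpsX * _) k - fps_coef (fpsC _ * _) k).
  rewrite coef_fpsC_mul !coef_fpsX_mul.
  by case: k => [|[|k]]; rewrite ?coef_fpsX_mul.
have uD : D \is a GRing.unit.
  rewrite -[_ \is a _]/(fps_coef D 0 \is a GRing.unit).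
  suff -> : fps_coef D 0 = 1 by apply: unitr1.
  rewrite -[LHS]/(1 - 0 - fps_coef (fpsC _ * _) 0) coef_fpsC_mul expr2.
  by rewrite coef_fpsX_mul mulr0 !subr0.
apply: (canRL (mulrK uD)); apply: fpsP => k; rewrite coefD.
rewrite -[RHS]/(fps_coef 1 k + fps_coef (fpsC _ * _) k) coef_fpsC_mul.
case: k => [|[|k]] /=;
  rewrite ?g0 ?g1 ?gS ?mulr0 ?mulr1 ?add0r ?addr0 ?subr0 //.
  by rewrite addrC addKr.
by rewrite addrAC addrK subrr.
Qed.

Theorem theorem4p3 :
  (forall n : nat, (2 <= n)%N ->
     [/\ CFCI (coxA n) = CFCI (coxB n),
         CFCI (coxB n) = CFCI (coxCt n.-1) &
         CFCI (coxCt n.-1) = CFCI (coxA n.-1) + fpsX * CFCI (coxA n.-2)])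
  /\ CFCI (coxA 0) = 1
  /\ CFCI (coxA 1) = 1 + fpsX
  /\ (let q : fps (fps int) := fpsC fpsX in
      let x : fps (fps int) := fpsX in
      Fps (fun n => if n is m.+1 then CFCI (coxA m) else 0)
      = x * ((1 + q * x) / (1 - x - q * x ^+ 2))).
Proof.
split; first case=> [//|[//|n _]].
  by rewrite !CFCI_coxA CFCI_coxB CFCI_coxCt sparse_series_rec.
rewrite !CFCI_coxA; split; first exact: sparse_series0.
split; first exact: sparse_series1.
move=> q x; rewrite -(@fps_recurrence _ _ (fun n => CFCI (coxA n))).
- by apply: fpsP => k; rewrite coef_fpsX_mul.
- by rewrite CFCI_coxA sparse_series0.
- by rewrite CFCI_coxA sparse_series1.
- by move=> n; rewrite !CFCI_coxA sparse_series_rec.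
Qed.
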